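(* Let $X:M \to \mathbb{R}^3_1$ be a conformal maximal immersion of a Riemann surface $M$ with $\partial(M) \neq \emptyset$, and suppose that the function $$n:M \to \mathbb{R}, \qquad n(p)=\|X(p)\|^2=\langle X(p),X(p)\rangle$$ is eventually positive (that is, positive outside a compact subset of $M$) and proper. Then $M$ is relative parabolic.
   Context: $\mathbb{R}^3_1$ denotes the Lorentz-Minkowski space: $\mathbb{R}^3$ with the metric $\langle\,,\rangle = dx_1^2+dx_2^2-dx_3^2$, and $\|(x_1,x_2,x_3)\|^2=x_1^2+x_2^2-x_3^2$ (possibly negative). Surfaces with boundary. Riemann surfaces are connected. A Riemann surface $M$ with $\partial(M)\neq\emptyset$ is assumed to satisfy $M\subseteq M'$ for an open Riemann surface $M'$; $\partial(M)\subset M$ is the topological frontier of $M$ in $M'$ and consists of a proper (without accumulation) family of pairwise disjoint closed curves in $M'$, at least piecewise $\mathcal{C}^1$ (closed as subsets of $M'$), some of which may be degenerate, i.e. isolated points. $\mathrm{Int}(M)=M-\partial(M)$. Maps on $M$ are called smooth (conformal, harmonic, meromorphic, ...) if they are restrictions of such maps on $M'$. Maximal immersions. A smooth map $X:M\to\mathbb{R}^3_1$ is spacelike if the metric induced from $\langle\,,\rangle$ is Riemannian at every point of $\mathrm{Int}(M)$. A conformal map $X:M\to\mathbb{R}^3_1$ is a (conformal) maximal immersion if it is spacelike and $X|_{\mathrm{Int}(M)}$ has zero mean curvature. The tangent plane at points of $\partial(M)$ is allowed to be non-Riemannian (singular boundary points). The Weierstrass data of $X$ are assumed to extend meromorphically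 beyond $\partial(M)$. Relative parabolicity. A Riemann surface $R$ with $\partial(R)\neq\emptyset$ is relative parabolic if the only bounded harmonic function $f$ on $R$ vanishing on $\partial(R)$ is $f=0$. *)

(* Defs.v *)
From HB Require Import structures.
From mathcomp Require Import all_boot all_order all_algebra.
From mathcomp Require Import all_classical all_reals all_analysis.
From mathcomp Require Import complex.

Set Implicit Arguments.
Unset Strict Implicit.
Unset Printing Implicit Defensive.
Import Order.TTheory GRing.Theory Num.Theory numFieldNormedType.Exports.

Local Open Scope classical_set_scope.
Local Open Scope ring_scope.
Local Open Scope complex_scope.

(* Charts take their values in R * R, which is a normed R-module. The field
   R[i] is a normed module over itself only, so it is used for holomorphy,
   where [derivable f w 1] is complex differentiability. *)
Definition to_C (R : realType) (z : R * R) : R[i]^o := z.1 +i* z.2.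
Definition of_C (R : realType) (w : R[i]^o) : R * R :=
  (complex.Re w, complex.Im w).

Definition on_C (R : realType) (f : R * R -> R[i]^o) : R[i]^o -> R[i]^o :=
  f \o @of_C R.

Definition holomorphic (R : realType) (V : set (R * R))
    (f : R * R -> R[i]^o) : Prop :=
  forall z, V z -> derivable (on_C f) (to_C z) 1.

(* The value of f at a pole is irrelevant. *)
Definition meromorphic (R : realType) (V : set (R * R))
    (f : R * R -> R[i]^o) : Prop :=
  forall z0, V z0 -> exists (n : nat) (W : set (R * R)) (g : R * R -> R[i]^o),
    [/\ nbhs z0 W, holomorphic W g &
        forall z, W z -> z <> z0 -> g z = (to_C z - to_C z0) ^+ n * f z].

Definition dir1 (R : realType) : R * R := (1, 0).
Definition dir2 (R : realType) : R * R := (0, 1).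

Fixpoint Ck (R : realType) (W : normedModType R) (k : nat) (V : set (R * R))
    (h : R * R -> W) : Prop :=
  {in V, continuous h} /\
  (if k is k'.+1 then
     [/\ forall z, V z -> derivable h z (dir1 R) /\ derivable h z (dir2 R),
         Ck k' V ('D_(dir1 R) h) & Ck k' V ('D_(dir2 R) h)]
   else True).

Definition laplacian (R : realType) (h : R * R -> R) (z : R * R) : R :=
  'D_(dir1 R) ('D_(dir1 R) h) z + 'D_(dir2 R) ('D_(dir2 R) h) z.

(* Only the values of [coord] on [dom] and of [param] on [coord @` dom]
   matter. *)
Record chart (R : realType) (S : topologicalType) := Chart {
  dom : set S;
  coord : S -> R * R;
  param : R * R -> S }.

Definition cimage (R : realType) (S : topologicalType) (c : chart R S)
  (A : set S) : set (R * R) := coord c @` (dom c `&` A).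

Definition is_chart (R : realType) (S : topologicalType) (c : chart R S) :
    Prop :=
  [/\ open (dom c) /\ open (cimage c setT),
      forall p, dom c p -> param c (coord c p) = p,
      {in dom c, continuous (coord c)} &
      {in cimage c setT, continuous (param c)}].

Definition transition (R : realType) (S : topologicalType) (c d : chart R S) :
  R * R -> R[i]^o := @to_C R \o coord d \o param c.

(* Second countability is not required: it follows from the other axioms
   (Rado). *)
Record riemannSurface (R : realType) := RiemannSurface {
  carrier :> topologicalType;
  atlas : set (chart R carrier);
  rs_hausdorff : hausdorff_space carrier;
  rs_connected : connected [set: carrier];
  rs_chart : forall c, atlas c -> is_chart c;
  rs_cover : forall p : carrier, exists2 c, atlas c & dom c p;
  rs_compat : forall c d, atlas c -> atlas d ->
    holomorphic (cimage c (dom d)) (transition c d) }.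

Definition open_surface (R : realType) (S : riemannSurface R) : Prop :=
  ~ compact [set: S].

Definition smooth (R : realType) (S : riemannSurface R)
    (W : normedModType R) (f : S -> W) : Prop :=
  forall c : chart R S, atlas c ->
    forall k, Ck k (cimage c setT) (f \o param c).

Definition harmonic (R : realType) (S : riemannSurface R) (A : set S)
    (f : S -> R) : Prop :=
  forall c : chart R S, atlas c ->
    Ck 2 (cimage c A) (f \o param c) /\
    forall z, cimage c A z -> laplacian (f \o param c) z = 0.

(** Surfaces with boundary *)

Definition frontier (T : topologicalType) (A : set T) : set T :=
  closure A `\` A°.

(* C^1 between consecutive points of D, up to the end points: one-sided limits
   of the derivative at the points of D. *)
Definition piecewise_C1 (R : realType) (S : riemannSurface R) (g : R -> S) :
    Prop :=
  continuous g /\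
  exists2 D : set R, (forall a b, finite_set (D `&` `[a, b])) &
    forall (c : chart R S) (t : R), atlas c -> dom c (g t) ->
      let h := coord c \o g in
      (~ D t -> derivable h t 1 /\ {for t, continuous (derive1 h)}) /\
      (D t -> cvg (derive1 h x @[x --> t^'-]) /\ cvg (derive1 h x @[x --> t^'+])).

Definition proper_line (R : realType) (S : riemannSurface R) (g : R -> S) :
    Prop :=
  injective g /\ forall K : set S, compact K -> compact (g @^-1` K).

Definition simple_loop (R : realType) (S : riemannSurface R) (g : R -> S) :
    Prop :=
  forall s t, g s = g t <-> exists k : int, s - t = k%:~R.

(* A one-dimensional piecewise C^1 submanifold that is closed as a subset:
   a Jordan curve or a properly embedded line. *)
Definition closed_C1_curve (R : realType) (S : riemannSurface R) (C : set S) :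
    Prop :=
  exists g : R -> S,
    [/\ C = range g, piecewise_C1 g & simple_loop g \/ proper_line g].

Definition locally_finite (T : topologicalType) (F : set (set T)) : Prop :=
  forall p : T, exists2 U, nbhs p U & finite_set [set C | F C /\ C `&` U !=set0].

(* M is a surface with boundary bd inside the open surface S.
   The degenerate (one-point) components of bd are marked points of M, and need
   not be frontier points of M: a point of M with a punctured neighbourhood in
   M is interior to M. Without them, bd is the frontier of M. The third
   condition says that M is a surface and not, for instance, a curve. *)
Definition bordered (R : realType) (S : riemannSurface R) (M bd : set S) :
    Prop :=
  [/\ closed M, connected M, M `<=` closure M°,
      frontier M `<=` bd /\ bd `<=` M &
      exists F : set (set S),
        [/\ bd = \bigcup_(C in F) C, trivIset F id, locally_finite F &
            forall C, F C -> (exists p, C = [set p]) \/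
                             (closed_C1_curve C /\ C `<=` frontier M)]].

(** Lorentz-Minkowski space and maximal immersions *)

Definition lorentz (R : realType) (u v : 'rV[R]_3) : R :=
  u 0 0 * v 0 0 + u 0 1 * v 0 1 - u 0 ord_max * v 0 ord_max.

(* The vector with lorentz (lcross u v) w = det (u, v, w) for all w. *)
Definition lcross (R : realType) (u v : 'rV[R]_3) : 'rV[R]_3 :=
  \row_(i < 3) [:: u 0 1 * v 0 ord_max - u 0 ord_max * v 0 1;
                   u 0 ord_max * v 0 0 - u 0 0 * v 0 ord_max;
                   - (u 0 0 * v 0 1 - u 0 1 * v 0 0)]`_i.

(* The normal of a spacelike surface is timelike. *)
Definition unit_normal (R : realType) (h : R * R -> 'rV[R]_3) (z : R * R) :
    'rV[R]_3 :=
  let L := lcross ('D_(dir1 R) h z) ('D_(dir2 R) h z) in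
  (Num.sqrt (- lorentz L L))^-1 *: L.

Definition mean_curvature (R : realType) (h : R * R -> 'rV[R]_3) (z : R * R) :
    R :=
  let h1 := 'D_(dir1 R) h in
  let h2 := 'D_(dir2 R) h in
  let N := unit_normal h z in
  let E := lorentz (h1 z) (h1 z) in
  let F := lorentz (h1 z) (h2 z) in
  let G := lorentz (h2 z) (h2 z) in
  let e := lorentz ('D_(dir1 R) h1 z) N in
  let f := lorentz ('D_(dir2 R) h1 z) N in
  let g := lorentz ('D_(dir2 R) h2 z) N in
  (e * G - 2 * f * F + g * E) / (2 * (E * G - F ^+ 2)).

(* The pulled back metric is a multiple of |dz|^2. The factor may vanish or be
   negative: singular points are allowed outside Int(M). *)
Definition conformal (R : realType) (S : riemannSurface R)
    (X : S -> 'rV[R]_3) : Prop :=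
  forall c : chart R S, atlas c -> forall z, cimage c setT z ->
    let h1 := 'D_(dir1 R) (X \o param c) z in
    let h2 := 'D_(dir2 R) (X \o param c) z in
    lorentz h1 h1 = lorentz h2 h2 /\ lorentz h1 h2 = 0.

Definition spacelike (R : realType) (S : riemannSurface R) (A : set S)
    (X : S -> 'rV[R]_3) : Prop :=
  forall c : chart R S, atlas c -> forall z, cimage c A z ->
    forall a b : R, (a, b) <> (0, 0) ->
      let v := a *: 'D_(dir1 R) (X \o param c) z
             + b *: 'D_(dir2 R) (X \o param c) z in
      0 < lorentz v v.

(* Coefficient of the 1-form phi_j = 2 (dX_j/dz) dz, where
   2 d/dz = d/dx - i d/dy. *)
Definition wcoef (R : realType) (S : riemannSurface R) (X : S -> 'rV[R]_3)
    (c : chart R S) (j : 'I_3) (z : R * R) : R[i]^o :=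
  ('D_(dir1 R) (X \o param c) z) 0 j
    +i* (- ('D_(dir2 R) (X \o param c) z) 0 j).

(* A meromorphic 1-form on U is given by its coefficient in each chart. The
   transformation rule may fail at the poles, whence the punctured
   neighbourhoods. *)
Definition meromorphic_form (R : realType) (S : riemannSurface R) (U : set S)
    (a : chart R S -> R * R -> R[i]^o) : Prop :=
  (forall c : chart R S, atlas c -> meromorphic (cimage c U) (a c)) /\
  forall c d : chart R S, atlas c -> atlas d ->
    forall p, (U `&` dom c `&` dom d) p ->
      \forall q \near p^',
        a c (coord c q) =
        a d (coord d q) * 'D_1 (on_C (transition c d)) (to_C (coord c q)).

(* The forms phi_1, phi_2, phi_3 extend meromorphically to a neighbourhood of
   M; hence so does the Gauss map g = i phi_3 / (phi_1 - i phi_2). *)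
Definition weierstrass_extends (R : realType) (S : riemannSurface R)
    (M bd : set S) (X : S -> 'rV[R]_3) : Prop :=
  exists2 U : set S, open U /\ M `<=` U &
    forall j : 'I_3, exists2 a : chart R S -> R * R -> R[i]^o,
      meromorphic_form U a &
      forall c : chart R S, atlas c -> forall z, cimage c (M `\` bd) z ->
        a c z = wcoef X c j z.

(* X is defined on the whole of S: a smooth or conformal map on M is the
   restriction of such a map on S. *)
Definition conformal_maximal_immersion (R : realType) (S : riemannSurface R)
    (M bd : set S) (X : S -> 'rV[R]_3) : Prop :=
  [/\ smooth X,
      conformal X,
      spacelike (M `\` bd) X,
      forall c : chart R S, atlas c -> forall z, cimage c (M `\` bd) z ->
        mean_curvature (X \o param c) z = 0 &
      weierstrass_extends M bd X].

(** Functions on M *)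

Definition eventually_positive (R : realType) (T : topologicalType)
    (M : set T) (n : T -> R) : Prop :=
  exists K : set T, [/\ compact K, K `<=` M & forall p, (M `\` K) p -> 0 < n p].

Definition proper_on (R : realType) (T : topologicalType) (M : set T)
    (n : T -> R) : Prop :=
  forall K : set R, compact K -> compact (M `&` n @^-1` K).

(* Harmonic on M means continuous on M and harmonic in Int(M), as usual for
   boundary value problems. In particular this covers restrictions to M of
   harmonic functions on S; with only those, every M having a boundary arc
   without analytic sub-arcs would trivially be relative parabolic. *)
Definition relative_parabolic (R : realType) (S : riemannSurface R)
    (M bd : set S) : Prop :=
  forall f : S -> R,
    {within M, continuous f} ->
    harmonic (M `\` bd) f ->
    (exists B : R, forall p, M p -> `|f p| <= B) ->
    (forall p, bd p -> f p = 0) ->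
    forall p, M p -> f p = 0.

(* Main.v *)
Require Import Defs.
From mathcomp Require Import all_boot all_order all_algebra.
From mathcomp Require Import all_classical all_reals all_analysis.
From mathcomp Require Import ring lra.

(** Let [n = <X, X>]. In a chart a conformal maximal immersion is harmonic, so
    the Laplacian of [n] is [4 * E], where [E] is the conformal factor; and
    because the normal of the surface is timelike, the tangential part of the
    position vector is at least as long as the position vector, so that
    [|grad n|^2 >= 4 * E * n]. Therefore [ln n] is superharmonic where [n > 0]
    ([subharmonic_sub_ln]). As [n] is proper and eventually positive, it tends
    to infinity at the ends of [M], and so does [ln n].

    Let [f] be bounded, harmonic, and zero on the boundary. The set of points of
    [M] with [n <= 1] is compact. Comparing [f] with multiples [e * ln n] for
    small [e > 0] shows that [f] is bounded above by the maximum of [0] and of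
    its values on this compact set ([harmonic_le]). So if [f] is positive
    somewhere, it has a positive maximum on [M], which is attained off the
    boundary. By the strong maximum principle and the connectedness of [M] the
    function [f] is constant, which is absurd since the boundary is nonempty
    ([harmonic_le0]). The same holds for [- f].

    The strong maximum principle ([strong_maximum], [maximum_principle]) is
    proved with the barrier [1 / |z - a|^2], and uses nothing beyond the sign of
    second derivatives at a maximum. That [X] is harmonic uses the symmetry of
    second derivatives ([schwarz]). *)

Set Implicit Arguments.
Unset Strict Implicit.
Unset Printing Implicit Defensive.
Import Order.TTheory GRing.Theory Num.Theory numFieldNormedType.Exports.

Local Open Scope classical_set_scope.
Local Open Scope ring_scope.

(** * Directional derivatives *)

Section directional.
Context {R : realType} {V : normedModType R}.
Implicit Types (u uv uw uvw uwv f g : V -> R) (a b c : R) (v w z : V).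

Lemma is_derive_line u z v t d :
  is_derive (t *: v + z) v u d -> is_derive t 1 (fun s : R => u (s *: v + z)) d.
Proof.
suff E : (fun h : R => h^-1 *:
           (((fun s : R => u (s *: v + z)) \o shift t) (h *: 1)
            - u (t *: v + z))) =
         (fun h : R => h^-1 *:
           ((u \o shift (t *: v + z)) (h *: v) - u (t *: v + z))).
  by case=> d1 d2; split; rewrite /derivable /derive E.
apply/funext => h /=; congr (_ *: (u _ - _)).
by rewrite [h *: 1]mulr1 scalerDl addrA.
Qed.

Lemma is_derive_line0 u z v d :
  is_derive (0 : R) 1 (fun s : R => u (s *: v + z)) d -> is_derive z v u d.
Proof.
suff E : (fun h : R => h^-1 *:
           (((fun s : R => u (s *: v + z)) \o shift 0) (h *: 1)
            - u (0 *: v + z))) =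
         (fun h : R => h^-1 *: ((u \o shift z) (h *: v) - u z)).
  by case=> d1 d2; split; move: d1 d2; rewrite /derivable /derive E.
by apply/funext => h /=; rewrite [h *: 1]mulr1 addr0 scale0r add0r.
Qed.

Lemma is_derive_comp1 u (phi : R -> R) z v a b :
  is_derive z v u a -> is_derive (u z) 1 phi b ->
  is_derive z v (phi \o u) (b * a).
Proof.
move=> ua phib; apply: is_derive_line0.
apply: (@is_derive1_comp _ phi (fun s : R => u (s *: v + z))).
  by rewrite scale0r add0r.
by apply: is_derive_line; rewrite scale0r add0r.
Qed.

Lemma second_derivative_max1 (g g' : R -> R) (d : R) :
  (\forall t \near (0 : R), is_derive t (1 : R) g (g' t)) ->
  (\forall t \near (0 : R), g t <= g 0) ->
  is_derive (0 : R) 1 g' d -> d <= 0.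
Proof.
move=> dg gmax dg'; rewrite leNgt; apply/negP => d0.
have : \forall t \near (0 : R), is_derive t (1 : R) g (g' t) /\ g t <= g 0.
  by near=> t; split; near: t.
move=> /nbhs_ballP[r /= r0 rP].
have inr t : `|t| < r -> is_derive t (1 : R) g (g' t) /\ g t <= g 0.
  by move=> tr; apply: rP; rewrite /ball /= sub0r normrN.
have g'0 : g' 0 = 0.
  have H0 : is_derive (0 : R) 1 g 0.
    apply: (@derive1_at_max R g (- r) r 0).
    - by rewrite ge0_cp// ltW.
    - move=> t; rewrite in_itv/= => tr.
      by case: (inr t _) => [|[]]//; rewrite ltr_norml.
    - by rewrite in_itv/= oppr_lt0 r0.
    - move=> t; rewrite in_itv/= => tr.
      by case: (inr t _) => //; rewrite ltr_norml.
  have [[_ <-] _] := inr 0 (ltac:(by rewrite normr0)).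
  by case: H0.
have [dg'1 dg'2] := dg'.
have : \forall h \near 0^', 0 < h^-1 *: ((g' \o shift 0) (h *: 1) - g' 0).
  apply: (cvgr_gt d) => //.
  by rewrite -dg'2; exact: dg'1.
move=> /nbhs_ballP[q /= q0 qP].
have pos t : 0 < t -> t < q -> 0 < g' t.
  move=> t0 tq; have /= := qP t.
  rewrite /ball /= sub0r normrN gtr0_norm// => /(_ tq).
  rewrite /= gt_eqF// => /(_ isT).
  by rewrite g'0 subr0 addr0 [t *: 1]mulr1 pmulr_rgt0// invr_gt0.
(* g' is positive on ]0, q[, so g b > g 0, against the maximality of g 0. *)
pose b := Num.min r q / 2.
have mrq : 0 < Num.min r q by rewrite lt_min r0.
have b0 : 0 < b by rewrite divr_gt0.
have bm : b < Num.min r q by rewrite /b; lra.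
have br : b < r by rewrite (lt_le_trans bm)// ge_min lexx.
have bq : b < q by rewrite (lt_le_trans bm)// ge_min lexx orbT.
have [||c] := @MVT R g g' 0 b b0.
- move=> x; rewrite in_itv/= => /andP[x0 xb].
  by case: (inr x) => //; rewrite gtr0_norm//; lra.
- apply: derivable_within_continuous => x; rewrite in_itv/= => /andP[x0 xb].
  by case: (inr x) => [|[]]//; rewrite ger0_norm//; lra.
rewrite in_itv/= subr0 => /andP[c0 cb] E.
have [_ gb] : is_derive b 1 g (g' b) /\ g b <= g 0.
  by apply: inr; rewrite gtr0_norm.
have := pos c c0 (lt_trans cb bq).
have : 0 < g' c * b by rewrite mulr_gt0// pos// (lt_trans cb).
lra.
Unshelve. all: by end_near. Qed.

Lemma line_continuous z v (t : R) :
  {for t, continuous (fun s : R => s *: v + z)}.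
Proof. by apply: cvgD; [apply: cvgZr_tmp; exact: cvg_id|exact: cvg_cst]. Qed.

(** A second directional derivative is nonpositive at a local maximum. The
    first derivative is passed as a function [u'], so that the lemma applies to
    sums and compositions without computing ['D_v u] on a neighbourhood. *)
Lemma second_derivative_max u u' z v d :
  (\forall y \near z, is_derive y v u (u' y)) ->
  (\forall y \near z, u y <= u z) ->
  is_derive z v u' d -> d <= 0.
Proof.
move=> du umax du'.
have lc : (fun s : R => s *: v + z) @ 0 --> z.
  by have := @line_continuous z v 0;
    rewrite /prop_for /continuous_at /= scale0r add0r.
apply: (@second_derivative_max1 (fun s => u (s *: v + z))
  (fun s => u' (s *: v + z))).
- by near=> t; apply: is_derive_line; near: t; exact: lc _ du.
- by rewrite scale0r add0r; exact: lc _ umax.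
- by apply: is_derive_line; rewrite scale0r add0r.
Unshelve. all: by end_near. Qed.

(** The mean value theorem applied twice, first along [v], then along [w]. *)
Lemma double_difference u uv uvw z v w (h : R) : 0 < h ->
  (forall s t : R, 0 <= s <= h -> 0 <= t <= h ->
    is_derive (s *: v + (t *: w + z)) v u (uv (s *: v + (t *: w + z))) /\
    is_derive (t *: w + (s *: v + z)) w uv (uvw (t *: w + (s *: v + z)))) ->
  exists s t : R, [/\ 0 <= s <= h, 0 <= t <= h &
    u (h *: v + (h *: w + z)) - u (h *: v + z) - (u (h *: w + z) - u z) =
    uvw (t *: w + (s *: v + z)) * h ^+ 2].
Proof.
move=> h0 dP.
have hh : 0 <= h <= h by rewrite lexx ltW.
have h00 : (0 : R) <= 0 <= h by rewrite lexx ltW.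
pose g (s : R) := u (s *: v + (h *: w + z)) - u (s *: v + z).
pose g' (s : R) := uv (s *: v + (h *: w + z)) - uv (s *: v + z).
have dg (s : R) : 0 <= s <= h -> is_derive s (1 : R) g (g' s).
  move=> sh.
  have d1 : is_derive s (1 : R) (fun s => u (s *: v + (h *: w + z)))
              (uv (s *: v + (h *: w + z))).
    by apply: is_derive_line; have [d _] := dP s h sh hh; exact: d.
  have d2 : is_derive s (1 : R) (fun s => u (s *: v + z)) (uv (s *: v + z)).
    apply: is_derive_line; have [d _] := dP s 0 sh h00.
    by move: d; rewrite scale0r add0r.
  exact: is_deriveB.
have [||s] := @MVT R g g' 0 h h0.
- by move=> s; rewrite in_itv/= => /andP[s0 sh]; apply: dg; rewrite !ltW.
- apply: derivable_within_continuous => s; rewrite in_itv/= => sh.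
  by case: (dg s sh).
rewrite in_itv/= subr0 => /andP[s0 sh] Eg.
have s0h : 0 <= s <= h by rewrite !ltW.
pose k (t : R) := uv (t *: w + (s *: v + z)).
pose k' (t : R) := uvw (t *: w + (s *: v + z)).
have dk (t : R) : 0 <= t <= h -> is_derive t (1 : R) k (k' t).
  by move=> th; apply: is_derive_line; have [_ d] := dP s t s0h th; exact: d.
have [||t] := @MVT R k k' 0 h h0.
- by move=> t; rewrite in_itv/= => /andP[t0 th]; apply: dk; rewrite !ltW.
- apply: derivable_within_continuous => t; rewrite in_itv/= => th.
  by case: (dk t th).
rewrite in_itv/= subr0 => /andP[t0 th] Ek.
exists s, t; split; rewrite ?ltW//.
have Eg' : g' s = k h - k 0 by rewrite /g' /k scale0r add0r addrCA.
move: Eg; rewrite Eg' Ek /g scale0r !add0r => ->.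
by rewrite expr2 mulrA.
Qed.

(** Equality of mixed derivatives: both are limits of the same double difference
    quotient over small parallelograms with sides [h *: v] and [h *: w]. *)
Lemma schwarz u uv uw uvw uwv z v w :
  (\forall y \near z, [/\ is_derive y v u (uv y), is_derive y w u (uw y),
     is_derive y w uv (uvw y) & is_derive y v uw (uwv y)]) ->
  {for z, continuous uvw} -> {for z, continuous uwv} ->
  uvw z = uwv z.
Proof.
move=> du cvw cwv; apply/eqP; rewrite -subr_eq0 -normr_le0.
apply/ler_addgt0Pr => e e0; rewrite add0r.
have e2 : 0 < e / 2 by rewrite divr_gt0.
have : \forall y \near z, [/\ is_derive y v u (uv y), is_derive y w u (uw y),
     is_derive y w uv (uvw y) & is_derive y v uw (uwv y)] /\
   (`|uvw z - uvw y| <= e / 2 /\ `|uwv z - uwv y| <= e / 2).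
  have c1 := (cvgrPdist_le _ _).1 cvw _ e2.
  have c2 := (cvgrPdist_le _ _).1 cwv _ e2.
  exact: (filterI du (filterI (c1 _) (c2 _))).
move=> /nbhs_ballP[r /= r0 rP].
pose c := `|v| + `|w| + 1.
have c0 : 0 < c by rewrite ltr_wpDl// addr_ge0.
pose h := r / 2 / c.
have h0 : 0 < h by rewrite !divr_gt0.
have inr s t : 0 <= s <= h -> 0 <= t <= h -> ball z r (s *: v + (t *: w + z)).
  move=> /andP[s0 sh] /andP[t0 th].
  rewrite -ball_normE /ball_/= addrA opprD addrCA subrr addr0 normrN.
  rewrite (le_lt_trans (ler_normD _ _))// !normrZ !ger0_norm//.
  apply: (@le_lt_trans _ _ (h * c)).
    rewrite /c 2!mulrDr ler_wpDr//; first by rewrite mulr1 ltW.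
    by rewrite lerD// ler_wpM2r.
  by rewrite /h divfK ?gt_eqF//; lra.
have inr' s t : 0 <= s <= h -> 0 <= t <= h -> ball z r (t *: w + (s *: v + z)).
  by move=> *; rewrite addrCA; exact: inr.
have [|s1 [t1 [s1h t1h E1]]] := @double_difference u uv uvw z v w h h0.
  move=> s t sh th; split.
    by have [[d _ _ _] _] := rP _ (inr s t sh th); exact: d.
  by have [[_ _ d _] _] := rP _ (inr' s t sh th); exact: d.
have [|s2 [t2 [s2h t2h E2]]] := @double_difference u uw uwv z w v h h0.
  move=> s t sh th; split.
    by have [[_ d _ _] _] := rP _ (inr' t s th sh); exact: d.
  by have [[_ _ _ d] _] := rP _ (inr t s th sh); exact: d.
(* The double difference is symmetric in v and w, so the mixed derivatives
   agree at two points near z. *)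
have [_ [H1 _]] := rP _ (inr' s1 t1 s1h t1h).
have [_ [_ H2]] := rP _ (inr t2 s2 t2h s2h).
have E : uvw (t1 *: w + (s1 *: v + z)) = uwv (t2 *: v + (s2 *: w + z)).
  apply: (@mulIf _ (h ^+ 2)); first by rewrite expf_neq0// gt_eqF.
  apply: etrans (esym E1) _; apply: etrans E2.
  rewrite [h *: w + (h *: v + z)]addrCA.
  move: (u _) (u _) (u _) (u _) => c1 c2 c3 c4; ring.
rewrite E in H1; rewrite -(subrKA (uwv (t2 *: v + (s2 *: w + z)))).
apply: le_trans (ler_normD _ _) _.
rewrite [leRHS]splitr; apply: lerD; first exact: H1.
by rewrite distrC; exact: H2.
Qed.

Lemma is_derive_addf f g z v a b : is_derive z v f a -> is_derive z v g b ->
  is_derive z v (fun y => f y + g y) (a + b).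
Proof. exact: is_deriveD. Qed.

Lemma is_derive_mulf f g z v a b : is_derive z v f a -> is_derive z v g b ->
  is_derive z v (fun y => f y * g y) (a * g z + f z * b).
Proof.
move=> fa gb; apply: (@is_derive_eq _ _ _ (f * g)) (is_deriveM fa gb) _.
by rewrite addrC [a * _]mulrC.
Qed.

Lemma is_derive_cmulf c f z v a : is_derive z v f a ->
  is_derive z v (fun y => c * f y) (c * a).
Proof. exact: is_deriveZ. Qed.

End directional.

(** * The strong maximum principle in the plane *)

Section plane.
Context {R : realType}.
Local Notation plane := (R * R)%type.
Local Notation e1 := (dir1 R).
Local Notation e2 := (dir2 R).
Implicit Types (V : set plane) (u : plane -> R) (z a : plane).

(** [u] is continuous on [V] and has there pure second partial derivatives with
    a nonnegative sum. The partial derivatives are explicit functions rather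
    than iterated ['D_v], so that only their values on [V] matter. *)
Definition subharmonic V u : Prop :=
  {in V, continuous u} /\
  exists u1 u2 u11 u22 : plane -> R, forall z, V z ->
    [/\ is_derive z e1 u (u1 z), is_derive z e2 u (u2 z),
        is_derive z e1 u1 (u11 z), is_derive z e2 u2 (u22 z) &
        0 <= u11 z + u22 z].

(** The same with a vanishing Laplacian. *)
Definition plane_harmonic V u : Prop :=
  {in V, continuous u} /\
  exists u1 u2 u11 u22 : plane -> R, forall z, V z ->
    [/\ is_derive z e1 u (u1 z), is_derive z e2 u (u2 z),
        is_derive z e1 u1 (u11 z), is_derive z e2 u2 (u22 z) &
        u11 z + u22 z = 0].

Lemma plane_harmonic_subharmonic V u : plane_harmonic V u -> subharmonic V u.
Proof.
move=> [cu [u1 [u2 [u11 [u22 du]]]]]; split=> //; exists u1, u2, u11, u22.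
move=> z Vz; have [a1 a2 a11 a22 a0] := du z Vz.
by split; [exact: a1|exact: a2|exact: a11|exact: a22|rewrite a0].
Qed.

Lemma plane_harmonicW V V' u :
  V `<=` V' -> plane_harmonic V' u -> plane_harmonic V u.
Proof.
move=> VV' [cu [u1 [u2 [u11 [u22 du]]]]]; split.
  by move=> z; rewrite inE => Vz; apply: cu; rewrite inE; exact: VV'.
by exists u1, u2, u11, u22 => z /VV'; exact: du.
Qed.

Lemma plane_harmonicN V u :
  plane_harmonic V u -> plane_harmonic V (fun z => - u z).
Proof.
move=> [cu [u1 [u2 [u11 [u22 du]]]]]; split.
  by move=> z Vz; apply: cvgN; exact: cu.
exists (fun z => - u1 z), (fun z => - u2 z).
exists (fun z => - u11 z), (fun z => - u22 z).
move=> z Vz; have [a1 a2 a11 a22 a0] := du z Vz; split.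
- exact: is_deriveN a1.
- exact: is_deriveN a2.
- exact: is_deriveN a11.
- exact: is_deriveN a22.
- by rewrite -opprD a0 oppr0.
Qed.

(** The Euclidean distance, squared; the norm of [R * R] is the maximum norm. *)
Definition sqdist a z : R := (z.1 - a.1) ^+ 2 + (z.2 - a.2) ^+ 2.

Lemma is_derive_fst z (v : plane) : is_derive z v (fst : plane -> R) v.1.
Proof.
apply: is_derive_line0.
rewrite (_ : (fun s : R => _) = (fun s : R => s * v.1) + cst z.1)//.
apply: is_derive_eq; rewrite addr0.
by rewrite scaler0 add0r [_ *: 1]mulr1.
Qed.

Lemma is_derive_snd z (v : plane) : is_derive z v (snd : plane -> R) v.2.
Proof.
apply: is_derive_line0.
rewrite (_ : (fun s : R => _) = (fun s : R => s * v.2) + cst z.2)//.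
apply: is_derive_eq; rewrite addr0.
by rewrite scaler0 add0r [_ *: 1]mulr1.
Qed.

Lemma is_derive_sqdist a z (v : plane) :
  is_derive z v (sqdist a) (2 * ((z.1 - a.1) * v.1 + (z.2 - a.2) * v.2)).
Proof.
have d1 := is_derive_addf (is_derive_fst z v) (is_derive_cst (- a.1) z v).
have d2 := is_derive_addf (is_derive_snd z v) (is_derive_cst (- a.2) z v).
have d3 := is_derive_addf (is_derive_mulf d1 d1) (is_derive_mulf d2 d2).
apply: is_derive_eq (d3 : is_derive z v (sqdist a) _) _.
by rewrite /cst; ring.
Qed.

Lemma is_derive_inv_sqdist a z (v : plane) : sqdist a z != 0 ->
  is_derive z v (fun z => (sqdist a z)^-1)
   (- (sqdist a z)^-1 ^+ 2 * (2 * ((z.1 - a.1) * v.1 + (z.2 - a.2) * v.2))).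
Proof.
move=> s0; rewrite exprVn.
apply: (@is_derive_comp1 _ _ (sqdist a) GRing.inv).
  exact: is_derive_sqdist.
have := @is_deriveV R id (sqdist a z) 1 1 s0 _.
by rewrite [_ *: 1]mulr1; apply.
Qed.

Lemma is_derive2_inv_sqdist1 a z : sqdist a z != 0 ->
  is_derive z e1 (fun z => - (sqdist a z)^-1 ^+ 2 * (2 * (z.1 - a.1)))
   (8 * (z.1 - a.1) ^+ 2 * (sqdist a z)^-1 ^+ 3 - 2 * (sqdist a z)^-1 ^+ 2).
Proof.
move=> s0; have d1 := is_derive_cmulf 2 (is_derive_addf
  (is_derive_fst z e1) (is_derive_cst (- a.1) z e1)).
have d2 := is_derive_inv_sqdist e1 s0.
have d3 := is_derive_cmulf (-1) (is_derive_mulf (is_derive_mulf d2 d2) d1).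
rewrite (_ : (fun y => _) = (fun y => -1 * ((sqdist a y)^-1 * (sqdist a y)^-1
  * (2 * (fst y + cst (- a.1) y))))); last first.
  by apply/funext => y; rewrite mulN1r mulNr -expr2.
apply: is_derive_eq d3 _; rewrite /cst /=; move: (_^-1) => b; ring.
Qed.

Lemma is_derive2_inv_sqdist2 a z : sqdist a z != 0 ->
  is_derive z e2 (fun z => - (sqdist a z)^-1 ^+ 2 * (2 * (z.2 - a.2)))
   (8 * (z.2 - a.2) ^+ 2 * (sqdist a z)^-1 ^+ 3 - 2 * (sqdist a z)^-1 ^+ 2).
Proof.
move=> s0; have d1 := is_derive_cmulf 2 (is_derive_addf
  (is_derive_snd z e2) (is_derive_cst (- a.2) z e2)).
have d2 := is_derive_inv_sqdist e2 s0.
have d3 := is_derive_cmulf (-1) (is_derive_mulf (is_derive_mulf d2 d2) d1).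
rewrite (_ : (fun y => _) = (fun y => -1 * ((sqdist a y)^-1 * (sqdist a y)^-1
  * (2 * (snd y + cst (- a.2) y))))); last first.
  by apply/funext => y; rewrite mulN1r mulNr -expr2.
apply: is_derive_eq d3 _; rewrite /cst /=; move: (_^-1) => b; ring.
Qed.

Lemma continuous_sqdist a : continuous (sqdist a).
Proof.
move=> z.
have c1 : {for z, continuous (fun y : plane => y.1 - a.1)}.
  by apply: cvgB; [exact: cvg_fst|exact: cvg_cst].
have c2 : {for z, continuous (fun y : plane => y.2 - a.2)}.
  by apply: cvgB; [exact: cvg_snd|exact: cvg_cst].
exact: cvgD (cvgM c1 c1) (cvgM c2 c2).
Qed.

(** Let [u a < u z0] for some [a] close to [z0], and let [s] be the squared
    Euclidean distance to [a]. The Laplacian of [s^-1] is [4 * s ^- 2 > 0], so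
    [u + e * s^-1] has no local maximum away from [a]. For a suitable [e > 0]
    its values near [a] and on the boundary of a square around [a] are too
    small compared with its value at [z0], so that the maximum over the square
    with a disc around [a] removed would be attained in the interior. *)
Lemma strong_maximum V u z0 : open V -> subharmonic V u -> V z0 ->
  (forall z, V z -> u z <= u z0) -> \forall z \near z0, u z = u z0.
Proof.
move=> oV [cu [u1 [u2 [u11 [u22 su]]]]] Vz0 umax.
have /nbhs_ballP[r /= r0 rV] : nbhs z0 V by exact: open_nbhs_nbhs.
near=> a; apply/eqP; rewrite eq_le.
have [a1 a2] : ball z0 (r / 4) a.
  by near: a; apply: (nbhsx_ballx z0); rewrite divr_gt0.
move: a1 a2; rewrite /ball/= => a1 a2.
have r4 : r / 4 + r / 2 < r by lra.
have boxV z : `|z.1 - a.1| <= r / 2 -> `|z.2 - a.2| <= r / 2 -> V z.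
  move=> z1 z2; apply: rV; split; rewrite /ball/= distrC.
    rewrite -(subrKA a.1) (le_lt_trans (ler_normD _ _))//.
    by rewrite (le_lt_trans _ r4)// addrC lerD// distrC ltW.
  rewrite -(subrKA a.2) (le_lt_trans (ler_normD _ _))//.
  by rewrite (le_lt_trans _ r4)// addrC lerD// distrC ltW.
have Va : V a by apply: boxV; rewrite subrr normr0 divr_ge0// ltW.
rewrite umax//= leNgt; apply/negP => uam.
pose m := u z0; pose b := u a.
have : \forall z \near a, u z < (m + b) / 2.
  apply: (@cvgr_lt _ _ (nbhs a) (nbhs_filter a) u (u a)).
    by apply: cu; rewrite inE.
  by rewrite -/b; rewrite -/m -/b in uam; lra.
move=> /nbhs_ballP[q /= q0 qP].
(* The disc s <= p lies in the square ball of radius q. *)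
pose p := (q / 2) ^+ 2.
have p0 : 0 < p by rewrite exprn_gt0// divr_gt0.
have inner z : sqdist a z <= p -> u z < (m + b) / 2.
  rewrite /sqdist => zp; apply: qP; split; rewrite /ball/= distrC.
    rewrite -ltr_sqr ?nnegrE ?(ltW q0)// real_normK ?num_real//.
    have : 0 <= (z.2 - a.2) ^+ 2 by exact: sqr_ge0.
    have : p < q ^+ 2 by rewrite /p; nra.
    lra.
  rewrite -ltr_sqr ?nnegrE ?(ltW q0)// real_normK ?num_real//.
  have : 0 <= (z.1 - a.1) ^+ 2 by exact: sqr_ge0.
  have : p < q ^+ 2 by rewrite /p; nra.
  lra.
have mb : b < m by exact: uam.
(* With this e, u + e / s <= m wherever s = p. *)
pose e := (m - b) / 2 * p.
have e0 : 0 < e by rewrite mulr_gt0// divr_gt0// subr_gt0.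
(* Outside the square with half side r / 2 the value of s is at least Q. *)
pose Q := r ^+ 2 / 4.
have Q0 : 0 < Q by rewrite divr_gt0// exprn_gt0.
have z0Q : sqdist a z0 < Q.
  have E x : `|x| < r / 4 -> x ^+ 2 < r ^+ 2 / 16.
    move=> xr; have -> : r ^+ 2 / 16 = (r / 4) ^+ 2 by field.
    by rewrite -[x ^+ 2]real_normK ?num_real// ltr_sqr ?nnegrE// divr_ge0// ltW.
  move: Q0; rewrite /sqdist /Q; have := E _ a1; have := E _ a2; lra.
have z0p : p < sqdist a z0.
  by rewrite ltNge; apply/negP => /inner; rewrite -/m; lra.
pose box : set plane :=
  `[a.1 - r / 2, a.1 + r / 2] `*` `[a.2 - r / 2, a.2 + r / 2].
have boxP z : box z <-> `|z.1 - a.1| <= r / 2 /\ `|z.2 - a.2| <= r / 2.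
  by rewrite /box /= !in_itv/= -!ler_distl.
pose D := box `&` [set z | p <= sqdist a z].
have cD : compact D.
  apply: compact_closedI.
    by apply: compact_setX; exact: segment_compact.
  apply: (@closed_comp _ _ (sqdist a) [set x | p <= x]); last exact: closed_ge.
  by move=> *; exact: continuous_sqdist.
have Dz0 : D z0.
  split=> /=; last exact: ltW.
  by apply/boxP; split; apply: ltW;
    [apply: lt_trans a1 _|apply: lt_trans a2 _]; lra.
pose v z := u z + e * (sqdist a z)^-1.
have cv : {within D, continuous v}.
  apply: continuous_in_subspaceT => z; rewrite inE => -[/boxP[z1 z2] /= zp].
  apply: cvgD; first by apply: cu; rewrite inE; exact: boxV.
  apply: cvgMl_tmp; apply: cvgV; last exact: continuous_sqdist.
  by rewrite gt_eqF// (lt_le_trans p0).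
have [|c] := compact_EVT_max _ cD cv; first by exists z0.
rewrite inE => -[/boxP[c1 c2] /= cp] cmax.
have sc0 : 0 < sqdist a c by exact: lt_le_trans cp.
have vc : m + e * Q^-1 < v c.
  apply: lt_le_trans (cmax z0 _); last by rewrite inE.
  rewrite /v -/m ltrD2l ltr_pM2l// ltf_pV2// posrE//.
  exact: lt_trans z0p.
have Vc : V c by exact: boxV.
have cm : u c <= m by exact: umax.
have eQ : 0 < e * Q^-1 by rewrite mulr_gt0// invr_gt0.
have cp' : p < sqdist a c.
  rewrite ltNge; apply/negP => cp'.
  have cpE : sqdist a c = p by apply/eqP; rewrite eq_le cp'.
  have ep : e * p^-1 = (m - b) / 2 by rewrite /e mulfK ?gt_eqF.
  have := inner _ cp'; move: vc eQ; rewrite /v cpE ep; lra.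
have cQ : sqdist a c < Q.
  rewrite ltNge; apply/negP => Qc.
  have : e * (sqdist a c)^-1 <= e * Q^-1 by rewrite ler_pM2l// lef_pV2.
  move: vc; rewrite /v; lra.
have c1' : `|c.1 - a.1| < r / 2.
  rewrite -ltr_sqr ?nnegrE ?divr_ge0 ?(ltW r0)// real_normK ?num_real//.
  have : 0 <= (c.2 - a.2) ^+ 2 by exact: sqr_ge0.
  have -> : (r / 2) ^+ 2 = Q by rewrite /Q; field.
  move: cQ; rewrite /sqdist; lra.
have c2' : `|c.2 - a.2| < r / 2.
  rewrite -ltr_sqr ?nnegrE ?divr_ge0 ?(ltW r0)// real_normK ?num_real//.
  have : 0 <= (c.1 - a.1) ^+ 2 by exact: sqr_ge0.
  have -> : (r / 2) ^+ 2 = Q by rewrite /Q; field.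
  move: cQ; rewrite /sqdist; lra.
have nV : \forall z \near c, V z by exact: open_nbhs_nbhs.
have nD : \forall z \near c, D z.
  have n1 : \forall z \near c, p < sqdist a z.
    by apply: (@cvgr_gt _ _ (nbhs c) (nbhs_filter c) _ (sqdist a c)) => //;
      exact: continuous_sqdist.
  have n2 : \forall z \near c, `|z.1 - a.1| < r / 2.
    apply: (@cvgr_lt _ _ (nbhs c) (nbhs_filter c) (fun z => `|z.1 - a.1|)
      `|c.1 - a.1|) => //.
    by apply: cvg_norm; apply: cvgB; [exact: cvg_fst|exact: cvg_cst].
  have n3 : \forall z \near c, `|z.2 - a.2| < r / 2.
    apply: (@cvgr_lt _ _ (nbhs c) (nbhs_filter c) (fun z => `|z.2 - a.2|)
      `|c.2 - a.2|) => //.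
    by apply: cvg_norm; apply: cvgB; [exact: cvg_snd|exact: cvg_cst].
  apply: filterS3 n1 n2 n3 => z z1 z2 z3; split; last exact: ltW.
  by apply/boxP; split; exact: ltW.
have nmax : \forall z \near c, v z <= v c.
  by apply: filterS nD => z Dz; apply: cmax; rewrite inE.
have nS z : D z -> sqdist a z != 0.
  by move=> -[_ /= zp]; rewrite gt_eqF// (lt_le_trans p0).
have [_ _ d1 d2 lap] := su _ Vc.
have sc : sqdist a c != 0 by rewrite gt_eqF.
have H1 : u11 c + e * (8 * (c.1 - a.1) ^+ 2 *
    (sqdist a c)^-1 ^+ 3 - 2 * (sqdist a c)^-1 ^+ 2) <= 0.
  apply: (@second_derivative_max _ _ v (fun z => u1 z +
      e * (- (sqdist a z)^-1 ^+ 2 * (2 * (z.1 - a.1)))) c e1).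
  - apply: filterS2 nV nD => z Vz Dz; apply: is_derive_addf.
      by have [d1' d2' _ _ _] := su _ Vz.
    apply: is_derive_cmulf; apply: is_derive_eq.
      exact: is_derive_inv_sqdist (nS _ Dz).
    by rewrite /= mulr1 mulr0 addr0.
  - exact: nmax.
  apply: is_derive_addf d1 _.
  by apply: is_derive_cmulf; exact: is_derive2_inv_sqdist1.
have H2 : u22 c + e * (8 * (c.2 - a.2) ^+ 2 *
    (sqdist a c)^-1 ^+ 3 - 2 * (sqdist a c)^-1 ^+ 2) <= 0.
  apply: (@second_derivative_max _ _ v (fun z => u2 z +
      e * (- (sqdist a z)^-1 ^+ 2 * (2 * (z.2 - a.2)))) c e2).
  - apply: filterS2 nV nD => z Vz Dz; apply: is_derive_addf.
      by have [d1' d2' _ _ _] := su _ Vz.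
    apply: is_derive_cmulf; apply: is_derive_eq.
      exact: is_derive_inv_sqdist (nS _ Dz).
    by rewrite /= mulr1 mulr0 add0r.
  - exact: nmax.
  apply: is_derive_addf d2 _.
  by apply: is_derive_cmulf; exact: is_derive2_inv_sqdist2.
(* The two inequalities add up to u11 + u22 + 4 * e / s ^ 2 <= 0. *)
have : 0 < 4 * e * (sqdist a c)^-1 ^+ 2.
  by rewrite mulr_gt0 ?exprn_gt0 ?invr_gt0// mulr_gt0.
suff : 4 * e * (sqdist a c)^-1 ^+ 2 + (u11 c + u22 c) <= 0 by lra.
apply: le_trans (_ : _ <= 0 + 0) _; last by rewrite addr0.
apply: le_trans (lerD H1 H2); move: (u11 c) (u22 c) => x y.
rewrite le_eqVlt; apply/orP; left; apply/eqP.
have : (sqdist a c)^-1 ^+ 3 * ((c.1 - a.1) ^+ 2 + (c.2 - a.2) ^+ 2) =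
   (sqdist a c)^-1 ^+ 2 by rewrite -/(sqdist a c) exprSr mulfVK.
move: (_^-1) => k.
move: (k ^+ 3) (k ^+ 2) => k3 k2 <-; ring.
Unshelve. all: by end_near. Qed.

End plane.

(** * Algebra of the Lorentz product *)

Section lorentz_algebra.
Context {R : realType}.
Implicit Types (u v w a b : 'rV[R]_3) (k : R).

Lemma lorentzC u v : lorentz u v = lorentz v u.
Proof. by rewrite /lorentz; ring. Qed.

Lemma lorentzDl u v w : lorentz (u + v) w = lorentz u w + lorentz v w.
Proof. by rewrite /lorentz !mxE; ring. Qed.

Lemma lorentzZr k u v : lorentz u (k *: v) = k * lorentz u v.
Proof. by rewrite /lorentz !mxE; ring. Qed.

(** Decomposition of the Lorentz product in the frame [u], [v], [lcross u v]. *)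
Lemma lorentz_gram u v a b :
  (lorentz u u * lorentz v v - lorentz u v ^+ 2) * lorentz a b =
  lorentz v v * (lorentz a u * lorentz b u)
  - lorentz u v * (lorentz a u * lorentz b v + lorentz a v * lorentz b u)
  + lorentz u u * (lorentz a v * lorentz b v)
  - lorentz a (lcross u v) * lorentz b (lcross u v).
Proof. rewrite /lorentz /lcross !mxE /=; ring. Qed.

Lemma lorentz_lcross u v :
  lorentz (lcross u v) (lcross u v) =
  lorentz u v ^+ 2 - lorentz u u * lorentz v v.
Proof. rewrite /lorentz /lcross !mxE /=; ring. Qed.

(** [h1], [h2], [h11], [h12], [h22] stand for the partial derivatives of a
    conformal spacelike immersion at a point; the four equations in the middle
    are the derivatives of [E = G] and [F = 0]. They say that [h11 + h22] is
    normal, and zero mean curvature that its normal part vanishes. *)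
Lemma mean_curvature_vector_eq0 (h1 h2 h11 h12 h22 : 'rV[R]_3)
    (L := lcross h1 h2) (N := (Num.sqrt (- lorentz L L))^-1 *: L)
    (E := lorentz h1 h1) (F := lorentz h1 h2) (G := lorentz h2 h2) w :
  0 < E -> E = G -> F = 0 ->
  lorentz h11 h1 = lorentz h12 h2 -> lorentz h12 h1 = lorentz h22 h2 ->
  lorentz h11 h2 + lorentz h1 h12 = 0 -> lorentz h12 h2 + lorentz h1 h22 = 0 ->
  (lorentz h11 N * G - 2 * lorentz h12 N * F + lorentz h22 N * E) /
    (2 * (E * G - F ^+ 2)) = 0 ->
  lorentz (h11 + h22) w = 0.
Proof.
move=> E0 EG F0 G1 G2 F1 F2.
have LL : lorentz L L = - E ^+ 2.
  by rewrite lorentz_lcross -/E -/F -/G -EG F0; ring.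
have k0 : Num.sqrt (- lorentz L L) != 0.
  by rewrite LL opprK gt_eqF// sqrtr_gt0 exprn_gt0.
rewrite /N !lorentzZr F0 -EG mulr0 subr0 expr0n/= subr0 => /eqP.
rewrite mulf_eq0 invr_eq0 !mulf_eq0 pnatr_eq0/= !(gt_eqF E0)/= orbF.
rewrite -mulrDl -mulrDr !mulf_eq0 invr_eq0 (negbTE k0) (gt_eqF E0)/= orbF.
move=> /eqP HL.
have vL : lorentz (h11 + h22) L = 0 by rewrite lorentzDl.
have v1 : lorentz (h11 + h22) h1 = 0.
  by rewrite lorentzDl G1 addrC -F2 addrC (lorentzC h1).
have v2 : lorentz (h11 + h22) h2 = 0.
  by rewrite lorentzDl -G2 -F1 (lorentzC h1).
have : (E * G - F ^+ 2) * lorentz (h11 + h22) w = _ := lorentz_gram _ _ _ _.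
rewrite -/L -/E -/F -/G v1 v2 vL F0 -EG expr0n/= !(mul0r, mulr0, addr0, subr0).
by move=> /eqP; rewrite !mulf_eq0 !(gt_eqF E0) => /eqP.
Qed.

(** The normal being timelike, the tangential part of [h] has a Lorentz square
    at least that of [h]. *)
Lemma lorentz_gradient_ge (h h1 h2 : 'rV[R]_3) :
  0 < lorentz h1 h1 -> lorentz h1 h1 = lorentz h2 h2 -> lorentz h1 h2 = 0 ->
  lorentz h1 h1 * lorentz h h <= lorentz h1 h ^+ 2 + lorentz h2 h ^+ 2.
Proof.
move=> E0 EG F0; have := lorentz_gram h1 h2 h h.
rewrite F0 -EG !(lorentzC h) expr0n/= !(mul0r, mulr0, subr0) -!expr2.
set E := lorentz h1 h1 in EG E0 *; move=> H.
rewrite -(ler_pM2l E0) mulrA -expr2 H mulrDr.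
by have := sqr_ge0 (lorentz (lcross h1 h2) h); lra.
Qed.

End lorentz_algebra.

(** * The Lorentz square of a maximal immersion *)

Section lorentz_calculus.
Context {R : realType}.
Local Notation plane := (R * R)%type.
Local Notation e1 := (dir1 R).
Local Notation e2 := (dir2 R).
Implicit Types (V : set plane) (h p q : plane -> 'rV[R]_3) (z v : plane).

Lemma is_derive_coord p z v dp j :
  is_derive z v p dp -> is_derive z v (fun y => p y 0 j) (dp 0 j).
Proof.
move=> [d <-]; apply: DeriveDef; first by move/derivable_mxP: d; apply.
by rewrite derive_mx// mxE.
Qed.

Lemma is_derive_lorentz p q z v dp dq :
  is_derive z v p dp -> is_derive z v q dq ->
  is_derive z v (fun y => lorentz (p y) (q y))
    (lorentz dp (q z) + lorentz (p z) dq).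
Proof.
move=> pP qP.
have pj j := is_derive_coord j pP; have qj j := is_derive_coord j qP.
have d0 := is_derive_mulf (pj 0) (qj 0).
have d1 := is_derive_mulf (pj 1) (qj 1).
have d2 := is_derive_cmulf (-1) (is_derive_mulf (pj ord_max) (qj ord_max)).
have d := is_derive_addf (is_derive_addf d0 d1) d2.
rewrite (_ : (fun y => _) = (fun y => p y 0 0 * q y 0 0 + p y 0 1 * q y 0 1
    + -1 * (p y 0 ord_max * q y 0 ord_max))); last first.
  by apply/funext => y; rewrite mulN1r.
by apply: is_derive_eq d _; rewrite /lorentz; ring.
Qed.

Lemma continuous_coord (T : topologicalType) (p : T -> 'rV[R]_3) (x : T) j :
  {for x, continuous p} -> {for x, continuous (fun y => p y 0 j)}.
Proof.
move=> cp; apply: (@continuous_comp _ _ _ p (fun A : 'rV[R]_3 => A 0 j)) => //.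
exact: coord_continuous.
Qed.

Lemma continuous_lorentz (T : topologicalType) (p q : T -> 'rV[R]_3) (x : T) :
  {for x, continuous p} -> {for x, continuous q} ->
  {for x, continuous (fun y => lorentz (p y) (q y))}.
Proof.
move=> cp cq.
have pj j := continuous_coord (j := j) cp.
have qj j := continuous_coord (j := j) cq.
exact: cvgB (cvgD (cvgM (pj 0) (qj 0)) (cvgM (pj 1) (qj 1)))
            (cvgM (pj ord_max) (qj ord_max)).
Qed.

Lemma Ck2_mixed V h z : open V -> Ck 2 V h -> V z ->
  'D_e2 ('D_e1 h) z = 'D_e1 ('D_e2 h) z.
Proof.
move=> oV [_ [dh [_ [d1 _ [c21 _]]] [_ [d2 [c12 _] _]]]] Vz.
have iV : z \in V by rewrite inE.
apply/rowP => j; apply: (@schwarz _ _ (fun y => h y 0 j)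
  (fun y => 'D_e1 h y 0 j) (fun y => 'D_e2 h y 0 j)
  (fun y => 'D_e2 ('D_e1 h) y 0 j) (fun y => 'D_e1 ('D_e2 h) y 0 j) z e1 e2).
- have nV : \forall y \near z, V y by exact: open_nbhs_nbhs.
  apply: filterS nV => y Vy.
  have [a1 a2] := dh _ Vy; have [_ a12] := d1 _ Vy; have [a21 _] := d2 _ Vy.
  split; apply: is_derive_coord; apply: derivableP.
  - exact: a1.
  - exact: a2.
  - exact: a12.
  - exact: a21.
- exact: continuous_coord (c21 z iV).
- exact: continuous_coord (c12 z iV).
Qed.

Lemma Ck2_partials V h z : open V -> Ck 2 V h -> V z ->
  [/\ is_derive z e1 h ('D_e1 h z), is_derive z e2 h ('D_e2 h z),
      is_derive z e1 ('D_e1 h) ('D_e1 ('D_e1 h) z),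
      is_derive z e2 ('D_e2 h) ('D_e2 ('D_e2 h) z) &
      is_derive z e2 ('D_e1 h) ('D_e2 ('D_e1 h) z) /\
      is_derive z e1 ('D_e2 h) ('D_e2 ('D_e1 h) z)].
Proof.
move=> oV Ch Vz; have mix := Ck2_mixed oV Ch Vz.
have [_ [d [_ [d1 _ _]] [_ [d2 _ _]]]] := Ch.
have [a1 a2] := d _ Vz; have [a11 a12] := d1 _ Vz; have [a21 a22] := d2 _ Vz.
split.
- exact: (derivableP a1).
- exact: (derivableP a2).
- exact: (derivableP a11).
- exact: (derivableP a22).
- by split; [exact: (derivableP a12)|rewrite mix; exact: (derivableP a21)].
Qed.

Section maximal.
(** A conformal maximal immersion [h] of [V], with its partial derivatives. The
    last hypothesis is the vanishing of the mean curvature, in terms of them. *)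
Variables (V : set plane) (h h1 h2 h11 h12 h22 : plane -> 'rV[R]_3).
Hypothesis oV : open V.
Hypothesis dh : forall z, V z ->
  [/\ is_derive z e1 h (h1 z), is_derive z e2 h (h2 z),
      is_derive z e1 h1 (h11 z), is_derive z e2 h2 (h22 z) &
      is_derive z e2 h1 (h12 z) /\ is_derive z e1 h2 (h12 z)].
Hypothesis conf : forall z, V z ->
  lorentz (h1 z) (h1 z) = lorentz (h2 z) (h2 z) /\ lorentz (h1 z) (h2 z) = 0.
Hypothesis space : forall z, V z -> 0 < lorentz (h1 z) (h1 z).
Hypothesis H0 : forall z, V z ->
  let L := lcross (h1 z) (h2 z) in
  let N := (Num.sqrt (- lorentz L L))^-1 *: L in
  let E := lorentz (h1 z) (h1 z) in
  let F := lorentz (h1 z) (h2 z) in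
  let G := lorentz (h2 z) (h2 z) in
  (lorentz (h11 z) N * G - 2 * lorentz (h12 z) N * F + lorentz (h22 z) N * E) /
    (2 * (E * G - F ^+ 2)) = 0.

(** A conformal maximal immersion is harmonic; since the Lorentz product is
    nondegenerate it is enough to test its Laplacian against all [w]. *)
Lemma maximal_laplacian z w : V z -> lorentz (h11 z + h22 z) w = 0.
Proof.
move=> Vz; have [_ _ a11 a22 [a12 a21]] := dh Vz.
have nV : \forall y \near z, V y by exact: open_nbhs_nbhs.
have eqG (v : plane) a b :
  is_derive z v (fun y => lorentz (h1 y) (h1 y)) a ->
  is_derive z v (fun y => lorentz (h2 y) (h2 y)) b -> a = b.
  move=> [_ <-] [_ <-]; apply: near_eq_derive.
  by apply: filterS nV => y /conf[].
have eqF (v : plane) a :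
  is_derive z v (fun y => lorentz (h1 y) (h2 y)) a -> a = 0.
  move=> [_ <-]; rewrite -(derive_cst (0 : R) z v); apply: near_eq_derive.
  by apply: filterS nV => y /conf[].
have G1 := eqG _ _ _ (is_derive_lorentz a11 a11) (is_derive_lorentz a21 a21).
have G2 := eqG _ _ _ (is_derive_lorentz a12 a12) (is_derive_lorentz a22 a22).
have F1 := eqF _ _ (is_derive_lorentz a11 a21).
have F2 := eqF _ _ (is_derive_lorentz a12 a22).
have [EG F0] := conf Vz.
apply: mean_curvature_vector_eq0 EG F0 _ _ F1 F2 (H0 Vz); first exact: space.
  by move: G1; rewrite (lorentzC (h1 z)) (lorentzC (h2 z)); lra.
by move: G2; rewrite (lorentzC (h1 z)) (lorentzC (h2 z)); lra.
Qed.

(** Where the Lorentz square [n] of the immersion is positive, [ln n] is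
    superharmonic. Indeed the Laplacian of [n] is [4 * E], with [E] the
    conformal factor, and [lorentz_gradient_ge] bounds the square of its
    gradient from below by [4 * E * n], hence
    [Laplacian (ln n) = (n * Laplacian n - |grad n|^2) / n^2 <= 0], and
    subtracting a nonnegative multiple of [ln n] from a harmonic function makes
    it subharmonic. *)
Lemma subharmonic_sub_ln f u e : 0 <= e ->
  {in V, continuous h} -> plane_harmonic V f ->
  (forall z, V z -> 0 < lorentz (h z) (h z)) ->
  (forall z, V z -> u z = f z - e * ln (lorentz (h z) (h z))) ->
  subharmonic V u.
Proof.
move=> e0 ch [cf [f1 [f2 [f11 [f22 df]]]]] n0 uE.
pose n z := lorentz (h z) (h z).
have nV z : V z -> \forall y \near z, V y by move=> Vz; exact: open_nbhs_nbhs.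
have dn z v dp : is_derive z v h dp -> is_derive z v n (2 * lorentz dp (h z)).
  move=> hP; apply: is_derive_eq (is_derive_lorentz hP hP) _.
  by rewrite lorentzC; ring.
have dln z v dp : V z -> is_derive z v h dp ->
    is_derive z v (@ln R \o n) ((n z)^-1 * (2 * lorentz dp (h z))).
  move=> Vz hP; apply: is_derive_comp1 (dn _ _ _ hP) _.
  exact/is_derive1_ln/n0.
have dlnV z v p pv : V z -> is_derive z v h (p z) -> is_derive z v p pv ->
    is_derive z v (fun y => (n y)^-1 * (2 * lorentz (p y) (h y)))
     (2 * (lorentz pv (h z) + lorentz (p z) (p z)) / n z
      - (2 * lorentz (p z) (h z)) ^+ 2 / n z ^+ 2).
  move=> Vz hP pP; have nz : n z != 0 by rewrite gt_eqF// n0.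
  have dV : is_derive z v (fun y => (n y)^-1)
      (- (n z) ^- 2 * (2 * lorentz (p z) (h z))).
    apply: (@is_derive_comp1 _ _ n GRing.inv).
    by have := @is_deriveV R id (n z) 1 1 nz _; rewrite [_ *: 1]mulr1; apply.
  have dL := is_derive_cmulf 2 (is_derive_lorentz pP hP).
  apply: is_derive_eq (is_derive_mulf dV dL) _.
  by move: (lorentz _ _) (lorentz _ _) (lorentz _ _) => *; field.
split.
  move=> z; rewrite inE => Vz.
  have cn : {for z, continuous n}.
    by apply: continuous_lorentz; apply: ch; rewrite inE.
  have cln : {for z, continuous (fun y => ln (n y))}.
    apply: (@continuous_comp _ _ _ n (@ln R)) => //.
    by apply: continuous_ln; exact: n0.
  have cl : {for z, continuous (fun y => f y - e * ln (n y))}.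
    apply: cvgB; first by apply: cf; rewrite inE.
    by apply: cvgMl_tmp; exact: cln.
  rewrite /continuous_at uE//; apply: cvg_trans cl; apply: near_eq_cvg.
  by apply: filterS (nV z Vz) => y Vy; rewrite uE.
exists (fun y => f1 y + - e * ((n y)^-1 * (2 * lorentz (h1 y) (h y)))).
exists (fun y => f2 y + - e * ((n y)^-1 * (2 * lorentz (h2 y) (h y)))).
exists (fun z => f11 z + - e *
   (2 * (lorentz (h11 z) (h z) + lorentz (h1 z) (h1 z)) / n z
      - (2 * lorentz (h1 z) (h z)) ^+ 2 / n z ^+ 2)).
exists (fun z => f22 z + - e *
   (2 * (lorentz (h22 z) (h z) + lorentz (h2 z) (h2 z)) / n z
      - (2 * lorentz (h2 z) (h z)) ^+ 2 / n z ^+ 2)).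
move=> z Vz; have [g1 g2 g11 g22 F0] := df _ Vz.
have [a1 a2 a11 a22 _] := dh Vz.
have nu : \forall y \near z, f y + - e * (@ln R \o n) y = u y.
  by apply: filterS (nV z Vz) => y Vy; rewrite uE// mulNr.
split.
- apply: (near_eq_is_derive nu).
  exact: is_derive_addf g1 (is_derive_cmulf _ (dln _ _ _ Vz a1)).
- apply: (near_eq_is_derive nu).
  exact: is_derive_addf g2 (is_derive_cmulf _ (dln _ _ _ Vz a2)).
- exact: is_derive_addf g11 (is_derive_cmulf _ (dlnV _ _ _ _ Vz a1 a11)).
- exact: is_derive_addf g22 (is_derive_cmulf _ (dlnV _ _ _ _ Vz a2 a22)).
have L0 := maximal_laplacian (h z) Vz; rewrite lorentzDl in L0.
have [EG FF] := conf Vz.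
have gr := lorentz_gradient_ge (h z) (space Vz) EG FF.
have nz : 0 < n z by exact: n0.
rewrite -/(n z) in gr; rewrite -EG; move: L0 gr nz F0.
move: (n z) (lorentz _ _) (lorentz _ _) (lorentz _ _) (lorentz _ _)
  (lorentz _ _) => m k2 k1 E k22 k11 L0 gr m0 F0.
set w := (X in 0 <= X).
have -> : w = e * (4 * (k1 ^+ 2 + k2 ^+ 2 - E * m) / m ^+ 2).
  rewrite /w; have -> : f11 z = - f22 z by apply/eqP; rewrite -addr_eq0 F0.
  have -> : k11 = - k22 by apply/eqP; rewrite -addr_eq0 L0.
  by field; rewrite gt_eqF.
by rewrite mulr_ge0// divr_ge0 ?exprn_ge0 ?(ltW m0)// mulr_ge0// subr_ge0.
Qed.

End maximal.
End lorentz_calculus.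

(** * Charts and the maximum principle on a surface *)

(* Not the coordinates in a basis of a vector space, nor the harmonic series. *)
Local Notation coord := Defs.coord.
Local Notation harmonic := Defs.harmonic.

Section surface.
Context {R : realType} {S : riemannSurface R}.
Implicit Types (A M bd : set S) (c : chart R S).

Lemma CkW (W : normedModType R) k (V V' : set (R * R)) (g : R * R -> W) :
  V `<=` V' -> Ck k V' g -> Ck k V g.
Proof.
move=> VV'; elim: k g => [|k IH] g /= [cg dg]; split=> //.
- by move=> z; rewrite inE => Vz; apply: cg; rewrite inE; exact: VV'.
- by move=> z; rewrite inE => Vz; apply: cg; rewrite inE; exact: VV'.
- case: dg => d g1 g2; split; [|exact: IH..].
  by move=> z Vz; apply: d; exact: VV'.
Qed.

Lemma open_cimage c A : atlas c -> open A -> open (cimage c A).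
Proof.
move=> /rs_chart[[od oc] pc _ cp] oA; rewrite openE => _ [p [dp Ap] <-].
have cT : cimage c setT (coord c p) by exists p.
have n1 : nbhs (coord c p) (cimage c setT) by exact: open_nbhs_nbhs.
have n2 : nbhs (coord c p) (param c @^-1` A).
  apply: cp; first by rewrite inE.
  by rewrite pc//; exact: open_nbhs_nbhs.
apply: filterS2 n1 n2 => _ [q [dq _] <-] /=; rewrite pc// => Aq.
by exists q.
Qed.

Lemma cimageS c A B : A `<=` B -> cimage c A `<=` cimage c B.
Proof. by move=> AB _ [p [dp Ap] <-]; exists p; split => //; exact: AB. Qed.

Lemma cimage_param c A z : atlas c -> cimage c A z -> A (param c z).
Proof. by move=> /rs_chart[_ pc _ _] [p [dp Ap] <-]; rewrite pc. Qed.

Lemma near_chart c p : atlas c -> dom c p ->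
  \forall q \near p, param c (coord c q) = q.
Proof.
move=> /rs_chart[[od _] pc _ _] dp.
by apply: filterS (open_nbhs_nbhs (conj od dp)) => q; exact: pc.
Qed.

Lemma near_coord c p (Q : set (R * R)) : atlas c -> dom c p ->
  nbhs (coord c p) Q -> \forall q \near p, Q (coord c q).
Proof. by move=> /rs_chart[_ _ cc _] dp; apply: cc; rewrite inE. Qed.

Lemma smooth_continuous (W : normedModType R) (g : S -> W) :
  smooth g -> continuous g.
Proof.
move=> sg p; have [c ac dp] := rs_cover p.
have [cg _] := sg _ ac 0%N.
have pc : param c (coord c p) = p by have [_ + _ _] := rs_chart ac; apply.
have := cg (coord c p); rewrite inE => /(_ _).
have cT : cimage c setT (coord c p) by exists p.
move=> /(_ cT) gc U; rewrite -[in nbhs (g p)]pc => /gc /(near_coord ac dp).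
apply: filterS2 (near_chart ac dp) => q /= + Uq.
by move: Uq; rewrite /= => /[swap] ->.
Qed.

(** The points of [M] where [u] attains its upper bound [m] form a closed subset
    of [M]; if they all lie in the open set [A] where [u] is subharmonic, this
    subset is open by [strong_maximum]. Hence it is empty or [M]; the last
    hypothesis excludes [M]. *)
Lemma maximum_principle M A (u : S -> R) m :
  connected M -> {within M, continuous u} -> open A -> A `<=` M ->
  (forall c, atlas c -> subharmonic (cimage c A) (u \o param c)) ->
  (forall p, M p -> u p <= m) -> (forall p, M p -> u p = m -> A p) ->
  (exists2 p, M p & u p != m) ->
  forall p, M p -> u p != m.
Proof.
move=> conM cu oA AM sub ule umA [p0 Mp0 up0] p Mp.
apply: contra up0 => /eqP up.
suff BM : M `&` u @^-1` [set m] = M.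
  by move: Mp0; rewrite -BM => -[_ /= ->].
apply: conM.
- by exists p.
- exists (M `&` u @^-1` [set m]); last by rewrite setIA setIid.
  rewrite openE => q [Mq /= uq]; have Aq := umA _ Mq uq.
  have [c ac dq] := rs_cover q.
  have pc : param c (coord c q) = q by have [_ + _ _] := rs_chart ac; apply.
  have : \forall z \near coord c q,
      (u \o param c) z = (u \o param c) (coord c q).
    apply: (@strong_maximum _ (cimage c A)).
    - exact: open_cimage.
    - exact: sub.
    - by exists q.
    - by move=> z /(cimage_param ac) Az /=; rewrite pc uq; exact/ule/AM.
  move=> /(near_coord ac dq) nq.
  have nA : \forall y \near q, A y by exact: open_nbhs_nbhs.
  apply: filterS3 nA (near_chart ac dq) nq => y Ay yE /=.
  by rewrite yE pc uq => uy; split => //; exact: AM.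
- have : closed (u @^-1` [set m] : set (subspace M)).
    apply: preimage_closed; last exact: closed_eq.
    by move=> x _; exact: cu.
  by move=> /closed_subspaceP[V cV VM]; exists V => //; rewrite setIC -VM setIC.
Qed.

(** Off the frontier of [M] the set [bd] consists of points forming a locally
    finite, hence closed, set. That the boundary curves are closed is not
    needed, since they lie in the frontier. *)
Lemma bordered_interior_open M bd : bordered M bd -> open (M `\` bd).
Proof.
move=> [_ _ _ [fbd _] [F [bdE _ lF FP]]]; rewrite openE => p [Mp nbp].
have ip : M° p.
  by apply: contrapT => np; apply/nbp/fbd; split=> //; exact: subset_closure.
have [U Up finU] := lF p.
pose G := [set C | (F C /\ C `&` U !=set0) /\ exists q, C = [set q]].
have clG : closed (\bigcup_(C in G) C).
  apply: closed_bigcup.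
    by apply: sub_finite_set finU => C [].
  move=> _ [_ [q ->]]; apply: accessible_closed_set1.
  exact/hausdorff_accessible/rs_hausdorff.
have nG : nbhs p (~` \bigcup_(C in G) C).
  apply: open_nbhs_nbhs; split; first exact: closed_openC.
  by move=> [C [[FC _] _] Cp]; apply: nbp; rewrite bdE; exists C.
have nM : nbhs p M° by exact: nbhs_interior.
apply: filterS3 Up nM nG => q Uq Mq nGq; split; first exact: interior_subset.
rewrite bdE => -[C FC Cq]; case: (FP _ FC) => [[r Cr]|[_ Cf]].
  by apply: nGq; exists C => //; split; [split=> //; exists q|exists r].
by case: (Cf _ Cq).
Qed.

End surface.

(** * Comparison with the logarithm of the Lorentz square *)

Section parabolicity.
Context {R : realType} {S : riemannSurface R}.
Implicit Types (A I M bd : set S) (c : chart R S) (n f : S -> R).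
Local Notation sqn X := (fun p => lorentz (X p) (X p)).

Lemma compact_sublevel M n L : closed M -> continuous n ->
  eventually_positive M n -> proper_on M n ->
  compact (M `&` [set p | n p <= L]).
Proof.
move=> cM cn [K [cK KM Kpos]] prop.
have cKL : compact (K `|` (M `&` n @^-1` `[0, L])).
  by apply: compactU => //; apply: prop; exact: segment_compact.
apply: subclosed_compact cKL _.
  apply: closedI => //.
  apply: (@preimage_closed _ _ n [set x | x <= L]); last exact: closed_le.
  by move=> *; exact: cn.
move=> p [Mp /= nL]; have [Kp|nKp] := pselect (K p); [by left|right].
by split => //=; rewrite in_itv/= nL andbT ltW//; exact: Kpos.
Qed.

Lemma harmonic_chart I f c : harmonic I f -> atlas c ->
  plane_harmonic (cimage c I) (f \o param c).
Proof.
move=> hf ac.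
have [[cf [d [_ [d1 _ _]] [_ [d2 _ _]]]] lf] := hf c ac.
split=> //.
exists ('D_(dir1 R) (f \o param c)), ('D_(dir2 R) (f \o param c)).
exists ('D_(dir1 R) ('D_(dir1 R) (f \o param c))).
exists ('D_(dir2 R) ('D_(dir2 R) (f \o param c))).
move=> z Iz; split.
- by have [a _] := d z Iz; exact: (derivableP a).
- by have [_ a] := d z Iz; exact: (derivableP a).
- by have [a _] := d1 z Iz; exact: (derivableP a).
- by have [_ a] := d2 z Iz; exact: (derivableP a).
- exact: lf z Iz.
Qed.

Lemma subharmonic_minus_ln M bd (X : S -> 'rV[R]_3) f e A c :
  conformal_maximal_immersion M bd X ->
  (forall c, atlas c -> plane_harmonic (cimage c (M `\` bd)) (f \o param c)) ->
  0 <= e ->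
  open A -> A `<=` (M `\` bd) `&` [set p | 1 < lorentz (X p) (X p)] ->
  atlas c ->
  subharmonic (cimage c A)
    ((fun p => f p - e * ln (Num.max (lorentz (X p) (X p)) 1)) \o param c).
Proof.
move=> [smX cfX spX mcX _] hf e0 oA AM ac.
have AI : A `<=` M `\` bd by move=> p /AM[].
have Vint := @cimageS _ _ c _ _ AI.
have VT := @cimageS _ _ c A setT (@subsetT _ _).
have oV := open_cimage ac oA.
have Ch : Ck 2 (cimage c A) (X \o param c) := CkW VT (smX c ac 2%N).
have cf := plane_harmonicW Vint (hf c ac).
apply: (@subharmonic_sub_ln R (cimage c A) (X \o param c)
  ('D_(dir1 R) (X \o param c)) ('D_(dir2 R) (X \o param c))
  ('D_(dir1 R) ('D_(dir1 R) (X \o param c)))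
  ('D_(dir2 R) ('D_(dir1 R) (X \o param c)))
  ('D_(dir2 R) ('D_(dir2 R) (X \o param c))) oV _ _ _ _ (f \o param c) _ e e0).
- by move=> z Vz; exact: Ck2_partials oV Ch Vz.
- by move=> z Vz; exact: cfX c ac z (VT z Vz).
- move=> z Vz; have := spX c ac z (Vint z Vz) 1 0.
  rewrite scale1r scale0r addr0; apply.
  by move=> [] /eqP; rewrite oner_eq0.
- by move=> z Vz; exact: mcX c ac z (Vint z Vz).
- by case: Ch.
- exact: cf.
- move=> z /(cimage_param ac)/AM[_ /= n1].
  exact: lt_trans n1.
- move=> z /(cimage_param ac)/AM[_ /= n1].
  by rewrite max_l// ltW.
Qed.

(** The maximum of [f] over [M] is controlled by its values where [n <= 1],
    with [n] the Lorentz square of the immersion. If [f p0 > m], then for small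
    [e > 0] the function [u = f - e * ln (max n 1)] is still greater than [m] at
    [p0], and it attains its maximum because [f] is bounded and [n] proper. This
    happens only at interior points with [n > 1], where [u] is subharmonic,
    against [maximum_principle]. *)
Lemma harmonic_le M bd (X : S -> 'rV[R]_3) f m :
  bordered M bd -> bd !=set0 -> conformal_maximal_immersion M bd X ->
  eventually_positive M (sqn X) -> proper_on M (sqn X) ->
  {within M, continuous f} ->
  (forall c, atlas c -> plane_harmonic (cimage c (M `\` bd)) (f \o param c)) ->
  (exists B, forall p, M p -> f p <= B) ->
  (forall p, bd p -> f p = 0) -> 0 <= m ->
  (forall p, M p -> lorentz (X p) (X p) <= 1 -> f p <= m) ->
  forall p, M p -> f p <= m.
Proof.
move=> hM [b bdb] hX hpos hprop cf hf [B fB] f0 m0 fm p0 Mp0.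
have [cM conM _ [_ bdM] _] := hM.
have cX : continuous X by case: hX => smX *; exact: smooth_continuous.
pose n (p : S) := lorentz (X p) (X p).
have cn : continuous n by move=> p; apply: continuous_lorentz; exact: cX.
pose q (p : S) := ln (Num.max (n p) 1).
have max1 p : 1 <= Num.max (n p) 1 by rewrite le_max lexx orbT.
have q0 p : 0 <= q p by exact: ln_ge0.
have cq : continuous q.
  move=> p; apply: (@continuous_comp _ _ _ (fun p => Num.max (n p) 1) (@ln R)).
    apply: (@continuous_max R S n (cst 1)); first exact: cn.
    exact: cst_continuous.
  by apply: continuous_ln; rewrite (lt_le_trans ltr01).
rewrite leNgt; apply/negP => mf.
(* Then e * q p0 is at most half of f p0 - m. *)
pose e := (f p0 - m) / 2 / (q p0 + 1).
have q1 : 0 < q p0 + 1 by rewrite ltr_wpDl.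
have e0 : 0 < e by rewrite !divr_gt0// subr_gt0.
pose u p := f p - e * q p.
have cu : {within M, continuous u}.
  move=> x; apply: cvgB; first exact: cf.
  by apply: cvgMl_tmp; apply: (continuous_subspaceT cq).
have up0 : m < u p0.
  have eq0 : e * q p0 <= e * (q p0 + 1) by rewrite ler_pM2l// lerDl.
  have : e * (q p0 + 1) = (f p0 - m) / 2 by rewrite /e divfK// gt_eqF.
  rewrite /u; lra.
(* Where n > L, the function u is less than u p0. *)
pose L := expR ((B - u p0) / e).
pose C := M `&` [set p | n p <= Num.max L (n p0)].
have cC : compact C by exact: compact_sublevel.
have Cp0 : C p0 by split => //=; rewrite le_max lexx orbT.
have cuC : {within C, continuous u}.
  by apply: continuous_subspaceW cu => p [].
have [|c] := compact_EVT_max _ cC cuC; first by exists p0.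
rewrite inE => -[Mc _] cmax.
have u0c : u p0 <= u c by apply: cmax; rewrite inE.
have umax p : M p -> u p <= u c.
  move=> Mp; have [Cp|nCp] := pselect (C p); first by apply: cmax; rewrite inE.
  apply: le_trans u0c; have Ln : L < n p.
    rewrite ltNge; apply/negP => nL; apply: nCp; split => //=.
    by rewrite le_max nL.
  have : (B - u p0) / e <= q p.
    rewrite -[leLHS]expRK ler_ln ?posrE ?expR_gt0//.
      by rewrite le_max (ltW Ln).
    by rewrite (lt_le_trans ltr01).
  rewrite ler_pdivrMr// mulrC => Bq.
  change (f p - e * q p <= u p0); have := fB _ Mp; lra.
pose A := (M `\` bd) `&` [set p | 1 < n p].
have oA : open A.
  apply: openI; first exact: bordered_interior_open hM.
  apply: (@open_comp _ _ n [set x | 1 < x]); last exact: open_gt.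
  by move=> *; exact: cn.
have uA p : M p -> u p = u c -> A p.
  move=> Mp upc; have mup : m < u p by rewrite upc (lt_le_trans up0).
  have uf : u p <= f p by rewrite gerBl// mulr_ge0// ltW.
  split; first split => //.
    by move=> /f0 fp; move: mup uf; rewrite fp; lra.
  rewrite /= ltNge; apply/negP => /(fm _ Mp); move: mup uf; lra.
suff : u c != u c by rewrite eqxx.
apply: (@maximum_principle _ _ M A u (u c) conM cu oA _ _ umax uA _ c Mc).
- by move=> p [[]].
- by move=> d ad; apply: subharmonic_minus_ln hX hf (ltW e0) oA _ ad.
- exists b; first exact: bdM.
  apply/eqP => ub; have [[_ []]] : A b by apply: uA => //; exact: bdM.
  exact: bdb.
Qed.

(** By [harmonic_le] a positive supremum of [f] would be a maximum, attained at
    an interior point, and [f] would be constant by [maximum_principle]. *)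
Lemma harmonic_le0 M bd (X : S -> 'rV[R]_3) f :
  bordered M bd -> bd !=set0 -> conformal_maximal_immersion M bd X ->
  eventually_positive M (sqn X) -> proper_on M (sqn X) ->
  {within M, continuous f} ->
  (forall c, atlas c -> plane_harmonic (cimage c (M `\` bd)) (f \o param c)) ->
  (exists B, forall p, M p -> f p <= B) ->
  (forall p, bd p -> f p = 0) -> forall p, M p -> f p <= 0.
Proof.
move=> hM hbd hX hpos hprop cf hf fB f0 p0 Mp0.
have [cM conM _ [_ bdM] _] := hM.
have cX : continuous X by case: hX => smX *; exact: smooth_continuous.
pose n (p : S) := lorentz (X p) (X p).
have cn : continuous n by move=> p; apply: continuous_lorentz; exact: cX.
pose K := M `&` [set p | n p <= 1].
have cK : compact K by exact: compact_sublevel.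
have le m : 0 <= m -> (forall p, K p -> f p <= m) -> forall p, M p -> f p <= m.
  move=> m0 fm; apply: harmonic_le hM hbd hX hpos hprop cf hf fB f0 m0 _.
  by move=> p Mp np; exact: fm.
(* If n <= 1 nowhere on M, the bound m = 0 applies vacuously. *)
have [K0|/set0P/negP/negPn/eqP K0] := pselect (K !=set0); last first.
  by apply: le => // p; rewrite K0.
have cfK : {within K, continuous f} by apply: continuous_subspaceW cf => p [].
have [c] := compact_EVT_max K0 cK cfK.
rewrite inE => -[Mc _] cmax.
have fK p : K p -> f p <= f c by move=> Kp; apply: cmax; rewrite inE.
have [fc|fc] := leP (f c) 0.
  by apply: le => // p /fK /le_trans; apply.
have fle := le _ (ltW fc) fK.
have [b bdb] := hbd.
suff : f c != f c by rewrite eqxx.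
apply: (@maximum_principle _ _ M (M `\` bd) f (f c) conM cf
  (bordered_interior_open hM) _ _ fle _ _ c Mc).
- by move=> p [].
- by move=> d ad; exact/plane_harmonic_subharmonic/hf.
- move=> p Mp fp; split => // /f0 fp0; move: fc; rewrite -fp fp0 ltxx//.
- exists b; first exact: bdM.
  by rewrite f0// lt_eqF.
Qed.

End parabolicity.

Theorem theorem3p1 (R : realType) (S : riemannSurface R) (M bd : set S)
    (X : S -> 'rV[R]_3)
    (hS : open_surface S)
    (hM : bordered M bd)
    (hbd : bd !=set0)
    (hX : conformal_maximal_immersion M bd X)
    (hpos : eventually_positive M (fun p => lorentz (X p) (X p)))
    (hproper : proper_on M (fun p => lorentz (X p) (X p))) :
  relative_parabolic M bd.
Proof.
move=> f cf hf [B fB] f0 p Mp.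
have hf' c (ac : atlas c) := harmonic_chart hf ac.
have fle0 : f p <= 0.
  apply: harmonic_le0 hM hbd hX hpos hproper cf hf' _ f0 p Mp.
  by exists B => q /fB; exact/le_trans/ler_norm.
have Nfle0 : - f p <= 0.
  apply: (@harmonic_le0 R S M bd X (fun q => - f q) hM hbd hX hpos hproper) Mp.
  - by move=> x; apply: cvgN; exact: cf.
  - by move=> c ac; exact: plane_harmonicN (hf' c ac).
  - by exists B => q /fB; apply: le_trans; rewrite -normrN ler_norm.
  - by move=> q /f0 ->; rewrite oppr0.
by apply/eqP; rewrite eq_le fle0 -oppr_le0.
Qed.
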